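(* Let $\Sigma=(X,\mathcal{D},\phi)$ be the switched linear system on a Banach space $X$ generated by $\dot x=A_{d(t)}x(t)$, where $\{A_q: q\in Q\}$ is a family of generators of $C_0$-semigroups $T_q$ on $X$ and $\mathcal{D}$ is the set of piecewise constant functions $d:\mathbb{R}_+\to Q$. (i) If there exists a non-coercive Lyapunov function $V$ for $\Sigma$, then $0$ is uniformly globally weakly attractive. (ii) If $\Sigma$ is robustly forward complete, then the following two statements are equivalent: (a) there exists a non-coercive Lyapunov function $V$ for $\Sigma$; (b) $0$ is uniformly globally asymptotically stable, and hence exponentially stable.
   Context: Notation: $\mathbb{R}_+=[0,\infty)$. $\mathcal{K}$ is the set of continuous strictly increasing $\gamma:\mathbb{R}_+\to\mathbb{R}_+$ with $\gamma(0)=0$; $\mathcal{K}_\infty$ is the set of unbounded $\gamma\in\mathcal{K}$; $\mathcal{L}$ is the set of continuous decreasing $\gamma:\mathbb{R}_+\to\mathbb{R}_+$ with $\lim_{t\to\infty}\gamma(t)=0$; $\mathcal{KL}$ is the set of $\beta:\mathbb{R}_+^2\to\mathbb{R}_+$ with $\beta(\cdot,t)\in\mathcal{K}$ for all $t\ge0$ and $\beta(r,\cdot)\in\mathcal{L}$ for all $r>0$. Switched linear system: $X$ is a Banach space, $Q$ an index set, and each $A_q$ ($q\in Q$) is a closed linear operator generating a $C_0$-semigroup $T_q$ on $X$. $\mathcal{D}$ is the set of piecewise constant $d:\mathbb{R}_+\to Q$, meaning that every bounded half-open interval $[a,b)\subset\mathbb{R}_+$ can be partitioned into finitely many half-open intervals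 $[a_i,b_i)$ on each of which $d$ is constant. (Using intervals closed on the right instead is merely another convention.) For $d\in\mathcal{D}$ and $s=b_0<b_1<\dots<b_k=t$ with $d\equiv d_j$ on $[b_{j-1},b_j)$, put $\Phi_d(t,s)=T_{d_k}(t-b_{k-1})T_{d_{k-1}}(b_{k-1}-b_{k-2})\cdots T_{d_1}(b_1-s)$, $\Phi_d(s,s)=I$, and $\phi(t,x,d)=\Phi_d(t,0)x$. Robustly forward complete (RFC): for all $C>0,\tau>0$, $\sup\{\|\phi(t,x,d)\|_X : \|x\|_X\le C,\ t\in[0,\tau],\ d\in\mathcal{D}\}<\infty$. Non-coercive Lyapunov function: a continuous $V:X\to\mathbb{R}_+$ with $V(0)=0$ for which there exist $\psi_2\in\mathcal{K}_\infty$ and $\alpha\in\mathcal{K}$ such that $0<V(x)\le\psi_2(\|x\|_X)$ for all $x\in X\setminus\{0\}$, and $\dot V_d(x):=\liminf_{t\to+0}\frac1t\big(V(\phi(t,x,d))-V(x)\big)\le-\alpha(\|x\|_X)$ for all $x\in X$, $d\in\mathcal{D}$. Uniformly globally weakly attractive: for every $\varepsilon>0$ and $r>0$ there is $\tau=\tau(\varepsilon,r)$ such that for all $x$ with $\|x\|_X\le r$ and all $d\in\mathcal{D}$ there is $t\in[0,\tau]$ with $\|\phi(t,x,d)\|_X\le\varepsilon$. Uniformly globally asymptotically stable (UGAS): there is $\beta\in\mathcal{KL}$ with $\|\phi(t,x,d)\|_X\le\beta(\|x\|_X,t)$ for all $x\in X$, $d\in\mathcal{D}$, $t\ge0$. Exponentially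 stable: there are $M\ge1,\omega>0$ with $\|\phi(t,x,d)\|_X\le Me^{-\omega t}\|x\|_X$ for all $x\in X$, $d\in\mathcal{D}$, $t\ge0$. *)

(* Defs.v *)
From HB Require Import structures.
From mathcomp Require Import all_boot all_order all_algebra.
From mathcomp Require Import all_classical all_reals all_analysis.

Set Implicit Arguments.
Unset Strict Implicit.
Unset Printing Implicit Defensive.

Import Order.TTheory GRing.Theory Num.Theory.
Import numFieldNormedType.Exports.

Local Open Scope classical_set_scope.
Local Open Scope ring_scope.

(* Functions on R_+ are represented by functions on R of which only the
   restriction to [0, +oo) is constrained and used. *)
Section comparison_functions.
Context {R : realType}.
Implicit Types (g : R -> R) (b : R -> R -> R).

Definition classK g : Prop :=
  [/\ {within `[0, +oo[, continuous g},
      {in `[0, +oo[ &, {homo g : r s / r < s}} & g 0 = 0].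

Definition classKoo g : Prop :=
  classK g /\ forall M, exists2 r, 0 <= r & M < g r.

(* "decreasing" is read in the weak sense *)
Definition classL g : Prop :=
  [/\ {within `[0, +oo[, continuous g},
      {in `[0, +oo[, forall t, 0 <= g t},
      {in `[0, +oo[ &, {homo g : s t /~ s <= t}} &
      g t @[t --> +oo] --> 0].

Definition classKL b : Prop :=
  (forall t, 0 <= t -> classK (b^~ t)) /\ (forall r, 0 < r -> classL (b r)).

End comparison_functions.

Section semigroups.
Context {R : realType} {X : completeNormedModType R}.

(* A linear operator defined on a subspace: the values of [op_fun] outside of
   [op_dom] are irrelevant. *)
Record linear_operator := LinearOperator {
  op_dom : set X;
  op_fun : X -> X;
  op_dom0 : op_dom 0;
  op_domP : forall (a : R) x y,
    op_dom x -> op_dom y -> op_dom (a *: x + y);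
  op_linear : forall (a : R) x y, op_dom x -> op_dom y ->
    op_fun (a *: x + y) = a *: op_fun x + op_fun y }.

Definition closed_operator (A : linear_operator) : Prop :=
  closed [set xy : X * X | op_dom A xy.1 /\ xy.2 = op_fun A xy.1].

Definition C0_semigroup (T : R -> X -> X) : Prop :=
  [/\ forall t, 0 <= t -> linear (T t) /\ continuous (T t),
      forall x, T 0 x = x,
      forall s t x, 0 <= s -> 0 <= t -> T (s + t) x = T s (T t x) &
      forall x, T t x @[t --> 0^'+] --> x].

Definition generates (A : linear_operator) (T : R -> X -> X) : Prop :=
  let D x := (h^-1 *: (T h x - x)) @[h --> 0^'+] in
  op_dom A = [set x | cvg (D x)] /\
  forall x, op_dom A x -> D x --> op_fun A x.

End semigroups.
Arguments linear_operator {R} X.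

Section switched_system.
Context {R : realType} {Q : Type}.

Definition piecewise_constant (d : R -> Q) : Prop :=
  forall a b : R, 0 <= a -> a < b ->
    exists (n : nat) (l u : 'I_n -> R),
      partition setT (fun i => [set` `[l i, u i[]) [set` `[a, b[] /\
      forall i, {in `[l i, u i[ &, forall r s, d r = d s}.

(* [admissible d s t p]: p = [:: b_1; ...; b_k] with s < b_1 < ... < b_k = t
   and d is constant on every [b_(j-1), b_j), where b_0 = s. *)
Fixpoint constant_along (d : R -> Q) (s : R) (p : seq R) : Prop :=
  if p is b :: p' then
    {in `[s, b[, forall r, d r = d s} /\ constant_along d b p'
  else True.

Definition admissible (d : R -> Q) (s t : R) (p : seq R) : Prop :=
  itv_partition s t p /\ constant_along d s p.

Lemma admissible_exists (d : R -> Q) (s t : R) :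
  piecewise_constant d -> 0 <= s -> s <= t -> exists p, admissible d s t p.
Proof.
move=> dP s0; rewrite le_eqVlt => /predU1P[<-|st].
  by exists [::]; split=> //; split=> /=.
have [n [l [u [[lu_cover _ _] lu_cst]]]] := dP _ _ s0 st.
pose ss := [seq (l i, u i) | i : 'I_n].
have cvr r : s <= r < t -> exists2 c, c \in ss & c.1 <= r < c.2.
  move=> srt; have: [set` `[s, t[] r by rewrite /= in_itv.
  rewrite -lu_cover => -[i _]; rewrite /= in_itv /= => lr.
  by exists (l i, u i) => //; apply/mapP; exists i => //; rewrite mem_enum.
have cst c : c \in ss -> {in `[c.1, c.2[ &, forall r r', d r = d r'}.
  by move=> /mapP[i _ ->]; exact: lu_cst.
move: ss cvr cst => ss cvr cst.
move: n l u {s0} lu_cover lu_cst => _ _ _ _ _.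
move: st cvr cst; move: {2}(size ss) (leqnn (size ss)) => m.
elim: m s ss => [|m IH] s ss ssm st cvr cst.
  have [|c] := cvr s; first by rewrite lexx.
  by move: ssm; rewrite leqn0 size_eq0 => /eqP ->.
have [|c css /andP[cs sc]] := cvr s; first by rewrite lexx.
have sP v : v <= c.2 -> {in `[s, v[, forall r, d r = d s}.
  move=> vc r; rewrite in_itv /= => /andP[sr rv].
  apply: (cst _ css); rewrite in_itv /= ?cs ?sc // (le_trans cs sr) /=.
  exact: lt_le_trans vc.
have [tc|ct] := leP t c.2.
  exists [:: t]; split; first exact: itv_partition1.
  by split=> //; exact: sP.
have szr : (size (rem c ss) <= m)%N.
  by rewrite size_rem // -ltnS prednK //; case: (ss) css.
have cvr' r : c.2 <= r < t -> exists2 e, e \in rem c ss & e.1 <= r < e.2.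
  move=> /andP[cr rt].
  have [|e ess /andP[er re]] := cvr r; first by rewrite (le_trans (ltW sc) cr).
  exists e; last by rewrite er.
  have [ec|ec] := eqVneq e c; first by move: re; rewrite ec ltNge cr.
  by move: ess; rewrite (perm_mem (perm_to_rem css)) inE (negPf ec).
have [e /mem_rem|p [[pp pt] pcst]] := IH c.2 (rem c ss) szr ct cvr'.
  exact: cst.
exists (c.2 :: p); split; first by split=> //=; rewrite sc.
by split=> //; exact: sP.
Qed.

Context {X : completeNormedModType R}.
Variable T : Q -> R -> X -> X.

Fixpoint transition_along (d : R -> Q) (s : R) (p : seq R) (x : X) : X :=
  if p is b :: p' then transition_along d b p' (T (d s) (b - s) x) else x.

(* The value does not depend on the chosen subdivision: see [transitionE] and
   [admissible_exists]. *)
Definition transition (d : R -> Q) (t s : R) : X -> X :=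
  transition_along d s (xget [::] [set p | admissible d s t p]).

Lemma transitionE (d : R -> Q) (s t : R) (p : seq R) :
  (forall q, C0_semigroup (T q)) -> admissible d s t p ->
  transition d t s = transition_along d s p.
Proof.
move=> TC0 adp; apply/funext => x; rewrite /transition.
have: admissible d s t (xget [::] [set p | admissible d s t p]).
  exact: (@xgetPex _ [::] [set p | admissible d s t p]) (ex_intro _ p adp).
move: (xget _ _) => p'.
move: {2}(size p + size p')%N (leqnn (size p + size p')) => m.
elim: m s x p p' adp => [|m IH] s x [|b p] [|c p'] //.
- by move=> [/itv_partition_nil <- _] _ [/itv_partitionxx].
- by move=> adp _ [/itv_partition_nil st]; case: adp; rewrite st=> /itv_partitionxx.
have cons v w q : v < w -> admissible d s t (w :: q) -> s < v ->
    admissible d v t (w :: q) /\ forall x,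
    transition_along d s (w :: q) x =
    transition_along d v (w :: q) (T (d s) (v - s) x).
  move=> vw [[/=/andP[sw qw] qt] [wcst qcst]] sv.
  have dv : d v = d s by apply: wcst; rewrite in_itv /= ltW.
  split.
    split; first by split=> //=; rewrite vw.
    split=> // r; rewrite in_itv /= dv => /andP[vr rw].
    by apply: wcst; rewrite in_itv /= rw (le_trans (ltW sv)).
  move=> y /=; case: (TC0 (d s)) => _ _ TD _.
  by rewrite dv -TD ?subr_ge0 ?ltW // addrA subrK.
move=> adp sz adp'.
have sb : s < b by case: adp => -[/= /andP[]].
have sc : s < c by case: adp' => -[/= /andP[]].
have tl w q : admissible d s t (w :: q) -> admissible d w t q.
  by move=> [[/=/andP[_ ?] ?] [_ ?]].
have [bc|cb|bc] := ltgtP b c.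
- have [adc ->] := cons _ _ _ bc adp' sb.
  by rewrite [RHS]/=; apply: IH (tl _ _ adp) _ adc; move: sz; rewrite /= addSn.
- have [adb ->] := cons _ _ _ cb adp sc.
  rewrite [LHS]/=; apply: IH adb _ (tl _ _ adp').
  by move: sz; rewrite /= !addSn !addnS.
- rewrite /= -bc; apply: IH (tl _ _ adp) _ _; last by rewrite bc; exact: tl adp'.
  by move: sz; rewrite /= addSn addnS => /ltnW.
Qed.

Definition phi (t : R) (x : X) (d : R -> Q) : X := transition d t 0 x.

Definition robustly_forward_complete : Prop :=
  forall C tau : R, 0 < C -> 0 < tau ->
    (ereal_sup [set z : \bar R | exists x t d,
       [/\ (`|x| <= C)%R, (0 <= t <= tau)%R, piecewise_constant d &
           z = `|phi t x d|%R%:E]] < +oo)%E.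

Definition lie_derivative (V : X -> R) (d : R -> Q) (x : X) : \bar R :=
  limf_einf (fun t : R => (t^-1 * (V (phi t x d) - V x))%:E) 0^'+.

Definition noncoercive_lyapunov (V : X -> R) : Prop :=
  [/\ continuous V, forall x, 0 <= V x, V 0 = 0 &
      exists psi2 alpha : R -> R,
      [/\ classKoo psi2, classK alpha,
          forall x, x != 0 -> 0 < V x <= psi2 `|x| &
          forall x d, piecewise_constant d ->
            (lie_derivative V d x <= (- alpha `|x|)%R%:E)%E]].

Definition uniformly_globally_weakly_attractive : Prop :=
  forall eps r : R, 0 < eps -> 0 < r -> exists tau : R,
    forall x d, `|x| <= r -> piecewise_constant d ->
      exists2 t, 0 <= t <= tau & `|phi t x d| <= eps.

Definition UGAS : Prop :=
  exists2 beta : R -> R -> R, classKL beta &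
    forall x d t, piecewise_constant d -> 0 <= t ->
      `|phi t x d| <= beta `|x| t.

Definition exponentially_stable : Prop :=
  exists M omega : R, [/\ 1 <= M, 0 < omega &
    forall x d t, piecewise_constant d -> 0 <= t ->
      `|phi t x d| <= M * expR (- omega * t) * `|x|].

End switched_system.

(* Main.v *)
Require Import Defs.
From HB Require Import structures.
From mathcomp Require Import all_boot all_order all_algebra.
From mathcomp Require Import all_classical all_reals all_analysis.
From mathcomp Require Import ring lra.

Import Order.TTheory GRing.Theory Num.Theory.
Import numFieldNormedType.Exports.

Local Open Scope classical_set_scope.
Local Open Scope ring_scope.

(** A solution that stays outside of the ball of radius eps makes V decrease at
    a rate bounded away from 0. The hypothesis on V is only a bound on a lower
    right derivative, but along a solution V is left continuous, and a function
    that is left continuous and whose lower right Dini derivative is less than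
    -c decreases at rate c ([lower_right_decrease]). As V is nonnegative and
    starts below psi2 r, the time spent outside of the ball is bounded
    ([noncoercive_lyapunov_weakly_attractive]). The left continuity of
    solutions is that of C_0-semigroups, which rests on the uniform boundedness
    principle ([C0_semigroup_left_continuous]).

    No lower bound on V by a function of the norm is available, so stability
    must come from linearity. Robust forward completeness bounds the solution
    operators by some M on every bounded time interval. By homogeneity, weak
    attractivity gives, for every solution, a time at most tau at which the
    norm has been halved. If K is the supremum of the norms of the solution
    operators up to some horizon, restarting the solution at that time yields
    K <= M + K / 2, hence K <= 2 M whatever the horizon
    ([weakly_attractive_uniformly_bounded]). Weak attractivity with a small
    enough factor together with this global bound shows that all solution
    operators at some time tau have norm at most 1 / e, and iterating gives
    exponential decay ([contraction_exponentially_stable]). The same iteration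
    turns uniform global asymptotic stability into exponential stability,
    because by homogeneity beta 1 t bounds the norms of the solution operators
    at time t.

    Conversely, under exponential stability with rate w, the supremum over all
    signals and times of exp (w t) |phi t x d| is a norm on X that is
    equivalent to the given one; since signals can be concatenated, it is
    multiplied by at most exp (- w h) along any solution during a time h, and
    is thus a Lyapunov function
    ([exponentially_stable_noncoercive_lyapunov]). *)

(** * Linear comparison functions *)

Section linear_comparison_functions.
Context {R : realType}.

Lemma classK_linear (a : R) : 0 < a -> classK (fun r : R => a * r).
Proof.
move=> a0; split.
- by apply: continuous_subspaceT => r; apply: cvgM; [exact: cvg_cst|exact: cvg_id].
- by move=> r s _ _ rs; rewrite ltr_pM2l.
- by rewrite mulr0.
Qed.

Lemma classKoo_linear (a : R) : 0 < a -> classKoo (fun r : R => a * r).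
Proof.
move=> a0; split=> [|M]; first exact: classK_linear.
exists ((`|M| + 1) / a); first by rewrite divr_ge0 ?addr_ge0 // ltW.
by rewrite mulrC divfK ?gt_eqF // (le_lt_trans (ler_norm M)) // ltrDl.
Qed.

End linear_comparison_functions.

(** * Piecewise constant signals *)

Section signals.
Context {R : realType} {Q : Type}.
Implicit Types (d : R -> Q) (a b c s t : R) (p : seq R).

(** The condition that [piecewise_constant] imposes on [[a, b[]; it is isolated
    so that intervals can be glued together and translated one at a time. *)
Definition finitely_many_pieces d a b : Prop :=
  exists (n : nat) (l u : 'I_n -> R),
    partition setT (fun i => [set` `[l i, u i[]) [set` `[a, b[] /\
    forall i, {in `[l i, u i[ &, forall r s, d r = d s}.

Lemma finitely_many_pieces_cat d a c b : a <= c -> c <= b ->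
  finitely_many_pieces d a c -> finitely_many_pieces d c b ->
  finitely_many_pieces d a b.
Proof.
move=> ac cb [n [l [u [[lu_cov lu_triv lu0] lu_cst]]]].
move=> [m [l' [u' [[lu'_cov lu'_triv lu'0] lu'_cst]]]].
pose glue (f : 'I_n -> R) (g : 'I_m -> R) (i : 'I_(n + m)) :=
  match fintype.split i with inl j => f j | inr j => g j end.
(* Both endpoints are glued along the same case distinction, so a property of
   all the pieces of the two families holds for the glued family. *)
have glueE (P : R -> R -> Prop) : (forall i, P (l i) (u i)) ->
    (forall i, P (l' i) (u' i)) -> forall i, P (glue l l' i) (glue u u' i).
  by move=> Pl Pr i; rewrite /glue; case: fintype.split.
have glueL f g j : glue f g (lshift m j) = f j.
  by rewrite /glue -[lshift m j]/(unsplit (inl j)) unsplitK.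
have glueR f g j : glue f g (rshift n j) = g j.
  by rewrite /glue -[rshift n j]/(unsplit (inr j)) unsplitK.
have inL j r : l j <= r < u j -> a <= r < c.
  move=> lr; have : cover setT (fun i => [set` `[l i, u i[]) r.
    by exists j => //=; rewrite in_itv.
  by rewrite lu_cov /= in_itv.
have inR j r : l' j <= r < u' j -> c <= r < b.
  move=> lr; have : cover setT (fun i => [set` `[l' i, u' i[]) r.
    by exists j => //=; rewrite in_itv.
  by rewrite lu'_cov /= in_itv.
exists (n + m)%N, (glue l l'), (glue u u'); split; last first.
  exact: (glueE (fun x y => {in `[x, y[ &, forall r s, d r = d s})).
split; last first.
- move=> i _; apply: (glueE (fun x y => [set` `[x, y[] !=set0)) => j.
  + exact: lu0.
  + exact: lu'0.
- apply/trivIsetP => i j _ _ ij; apply/seteqP; split=> // r [] /=.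
  rewrite !in_itv /=; move: ij.
  rewrite -(splitK i) -(splitK j).
  case: (fintype.split i) (fintype.split j) => [i'|i'] [j'|j'] /= ij;
      rewrite ?glueL ?glueR => ri rj.
  + have ij' : i' != j' by apply: contraNneq ij => ->.
    have /trivIsetP/(_ i' j' I I ij') := lu_triv.
    by rewrite -subset0 => /(_ r); apply; split; rewrite /= in_itv.
  + by move: (inL _ _ ri) (inR _ _ rj); lra.
  + by move: (inR _ _ ri) (inL _ _ rj); lra.
  + have ij' : i' != j' by apply: contraNneq ij => ->.
    have /trivIsetP/(_ i' j' I I ij') := lu'_triv.
    by rewrite -subset0 => /(_ r); apply; split; rewrite /= in_itv.
- apply/seteqP; split=> r.
  + move=> [i _] /=; rewrite !in_itv /= -(splitK i).
    case: (fintype.split i) => [j|j] /=; rewrite ?glueL ?glueR.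
      by move/inL; lra.
    by move/inR; lra.
  + rewrite /= in_itv /=; have [rc|cr] := ltP r c => rab.
      have : [set` `[a, c[] r by rewrite /= in_itv /= rc andbT; case/andP: rab.
      rewrite -lu_cov => -[i _ /= ri].
      by exists (lshift m i) => //=; rewrite !glueL.
    have : [set` `[c, b[] r by rewrite /= in_itv /= cr; case/andP: rab.
    rewrite -lu'_cov => -[i _ /= ri].
    by exists (rshift n i) => //=; rewrite !glueR.
Qed.

Lemma finitely_many_pieces_translate d d' c a b :
  (forall r, a <= r < b -> d' (r + c) = d r) ->
  finitely_many_pieces d a b -> finitely_many_pieces d' (a + c) (b + c).
Proof.
move=> dd' [n [l [u [[lu_cov lu_triv lu0] lu_cst]]]].
have inlu j r : l j <= r < u j -> a <= r < b.
  move=> lr; have : cover setT (fun i => [set` `[l i, u i[]) r.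
    by exists j => //=; rewrite in_itv.
  by rewrite lu_cov /= in_itv.
have backE x y r : (x + c <= r < y + c) = (x <= r - c < y).
  by rewrite lerBrDr ltrBlDr.
exists n, (fun i => l i + c), (fun i => u i + c); split; last first => [i r s|].
  rewrite !in_itv /= !backE => ri si.
  rewrite -(subrK c r) -(subrK c s) !dd' ?(inlu _ _ ri) ?(inlu _ _ si) //.
  by apply: (lu_cst i); rewrite in_itv.
split.
- apply/seteqP; split=> r.
    by move=> [i _] /=; rewrite !in_itv /= !backE; exact: inlu.
  rewrite /= in_itv /= backE => rab.
  have : [set` `[a, b[] (r - c) by rewrite /= in_itv.
  rewrite -lu_cov => -[i _ /=]; rewrite in_itv /= => ri.
  by exists i => //=; rewrite in_itv /= backE.
- apply/trivIsetP => i j _ _ ij; apply/seteqP; split=> // r [] /=.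
  rewrite !in_itv /= !backE => ri rj.
  have /trivIsetP/(_ i j I I ij) := lu_triv.
  by rewrite -subset0 => /(_ (r - c)); apply; split; rewrite /= in_itv.
- move=> i _; have [r /=] := lu0 i I; rewrite in_itv /= => ri.
  by exists (r + c); rewrite /= in_itv /= backE addrK.
Qed.

Definition shift_signal s d : R -> Q := fun r => d (s + r).

Definition concat_signal s d d' : R -> Q :=
  fun r => if r < s then d r else d' (r - s).

Lemma piecewise_constant_shift s d : 0 <= s ->
  piecewise_constant d -> piecewise_constant (shift_signal s d).
Proof.
move=> s0 dP a b a0 ab.
rewrite -[a](addrK s) -[b](addrK s).
apply: (@finitely_many_pieces_translate d); last by apply: dP; lra.
by move=> r _; rewrite /shift_signal; congr d; ring.
Qed.

Lemma piecewise_constant_concat s d d' : 0 <= s -> piecewise_constant d ->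
  piecewise_constant d' -> piecewise_constant (concat_signal s d d').
Proof.
move=> s0 dP d'P.
have left a b : 0 <= a -> a < b -> b <= s ->
    finitely_many_pieces (concat_signal s d d') a b.
  move=> a0 ab bs; rewrite -[a]addr0 -[b]addr0.
  apply: (@finitely_many_pieces_translate d); last exact: dP.
  by move=> r rab; rewrite addr0 /concat_signal ifT //; lra.
have right a b : s <= a -> a < b ->
    finitely_many_pieces (concat_signal s d d') a b.
  move=> sa ab; rewrite -[a](subrK s) -[b](subrK s).
  apply: (@finitely_many_pieces_translate d'); last by apply: d'P; lra.
  by move=> r rab; rewrite /concat_signal ifF ?addrK //; lra.
move=> a b a0 ab; have [bs|sb] := leP b s; first exact: left.
have [as_|sa] := ltP a s; last exact: right.
by apply: (@finitely_many_pieces_cat _ a s b); [lra|lra|exact: left|exact: right].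
Qed.

End signals.

(** * The solution operators form a linear cocycle *)

Section cocycle.
Context {R : realType} {Q : Type} {X : completeNormedModType R}.
Context {T : Q -> R -> X -> X}.
Hypothesis TC0 : forall q, C0_semigroup (T q).
Implicit Types (d : R -> Q) (a b c s t : R) (p : seq R) (x y : X).

Lemma constant_along_cat d s p q : constant_along d s (p ++ q) <->
  constant_along d s p /\ constant_along d (last s p) q.
Proof.
elim: p s => [|b p IH] s /=; first by split=> [|[]].
by rewrite IH; split=> [[? []]|[[? ?]]].
Qed.

Lemma admissible_cat d s u t p q :
  admissible d s u p -> admissible d u t q -> admissible d s t (p ++ q).
Proof.
move=> [pP pc] [qP qc]; split; first exact: itv_partition_cat qP.
by apply/constant_along_cat; split=> //; case: pP => _ /eqP ->.
Qed.

Lemma transition_along_cat d s p q x : transition_along T d s (p ++ q) x =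
  transition_along T d (last s p) q (transition_along T d s p x).
Proof. by elim: p s x => [|b p IH] s x //=. Qed.

(** Time invariance at the level of subdivisions. The signals are only required
    to agree on [[s, t[], which makes this lemma serve both for shifting a
    signal and, with [c = 0], for changing it outside of [[s, t[]. *)
Lemma transition_along_translate d d' c s t p :
  (forall r, s <= r < t -> d' (r + c) = d r) -> admissible d s t p ->
  let p' := [seq b + c | b <- p] in
  admissible d' (s + c) (t + c) p' /\
  transition_along T d' (s + c) p' =1 transition_along T d s p.
Proof.
elim: p s => [|b p IH] s dd' ad /=.
  by case: ad => /itv_partition_nil <- _; do 2!split => //=.
case: ad => bp [/= dc pc].
have pP := itv_partition_cons bp.
have bt := itv_partition_le pP.
have sb : s < b by case: bp => /= /andP[].
have [] // := IH b.
  by move=> r rbt; apply: dd'; lra.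
move=> [[p'path p'last] p'c] tE.
have dsE : d' (s + c) = d s by apply: dd'; lra.
split; last by move=> x /=; rewrite tE dsE (_ : b + c - (s + c) = b - s) //; ring.
split; first by split=> //=; rewrite p'path ltrD2r sb.
split=> // r; rewrite in_itv /= => rsb; rewrite dsE -(subrK c r).
by rewrite dd' ?dc ?in_itv //=; lra.
Qed.

Lemma transitionxx d s x : transition T d s s x = x.
Proof. by rewrite (@transitionE _ _ _ _ _ _ _ [::]). Qed.

Lemma transition_comp d s u t x : piecewise_constant d ->
  0 <= s -> s <= u -> u <= t ->
  transition T d t s x = transition T d t u (transition T d u s x).
Proof.
move=> dP s0 su ut.
have [p pP] := admissible_exists dP s0 su.
have [q qP] := admissible_exists dP (le_trans s0 su) ut.
rewrite (transitionE TC0 pP) (transitionE TC0 qP).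
rewrite (transitionE TC0 (admissible_cat _ _ _ _ _ _ pP qP)).
by rewrite transition_along_cat; case: pP => -[_ /eqP ->].
Qed.

Lemma transition_translate d d' c s t : piecewise_constant d ->
  0 <= s -> s <= t -> (forall r, s <= r < t -> d' (r + c) = d r) ->
  transition T d' (t + c) (s + c) = transition T d t s.
Proof.
move=> dP s0 st dd'; have [p pP] := admissible_exists dP s0 st.
have [p'P tE] := transition_along_translate _ _ _ _ _ _ dd' pP.
by rewrite (transitionE TC0 pP) (transitionE TC0 p'P); apply/funext.
Qed.

Lemma phi0 d x : phi T 0 x d = x.
Proof. exact: transitionxx. Qed.

Lemma phiD s t x d : piecewise_constant d -> 0 <= s -> 0 <= t ->
  phi T (s + t) x d = phi T t (phi T s x d) (shift_signal s d).
Proof.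
move=> dP s0 t0; rewrite /phi (@transition_comp _ _ s) //; last lra.
congr (_ _); rewrite -{2}(add0r s) addrC.
apply: transition_translate => //; first exact: piecewise_constant_shift.
by move=> r _; rewrite /shift_signal addrC.
Qed.

Lemma eq_phi t x d d' : piecewise_constant d -> 0 <= t ->
  (forall r, 0 <= r < t -> d' r = d r) -> phi T t x d' = phi T t x d.
Proof.
move=> dP t0 dd'; rewrite /phi.
have := @transition_translate d d' 0 0 t dP (lexx 0) t0.
by rewrite !addr0 => -> // r; rewrite addr0; exact: dd'.
Qed.

Lemma phi_concat s t x d d' : piecewise_constant d -> piecewise_constant d' ->
  0 <= s -> 0 <= t ->
  phi T (s + t) x (concat_signal s d d') = phi T t (phi T s x d) d'.
Proof.
move=> dP d'P s0 t0; have ddP := piecewise_constant_concat _ _ _ s0 dP d'P.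
rewrite phiD // (@eq_phi s _ d) //; last first.
  by move=> r rs; rewrite /concat_signal ifT //; lra.
apply: eq_phi => // r rt; rewrite /shift_signal /concat_signal ifF; last lra.
by congr d'; ring.
Qed.

Lemma phi_cst t x d : 0 <= t -> {in `[0, t[, forall r, d r = d 0} ->
  phi T t x d = T (d 0) t x.
Proof.
rewrite le_eqVlt => /predU1P[<- _|t0 dc].
  by rewrite phi0; case: (TC0 (d 0)) => _ ->.
rewrite /phi (@transitionE _ _ _ _ _ _ _ [:: t]) //= ?subr0 //.
by split=> //; exact: itv_partition1.
Qed.

Lemma phi_linear t d : 0 <= t -> piecewise_constant d ->
  linear (phi T t ^~ d).
Proof.
move=> t0 dP a x y /=; have [p] := admissible_exists dP (lexx 0) t0.
move=> pP; rewrite /phi (transitionE TC0 pP); case: pP => -[+ _] _.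
elim: p 0 x y => [|b p IH] s x y //= /andP[sb bp].
have [TL _ _ _] := TC0 (d s).
have /TL[Tlin _] : 0 <= b - s by lra.
by rewrite Tlin; exact: IH.
Qed.

Lemma phiZ t d (a : R) x : 0 <= t -> piecewise_constant d ->
  phi T t (a *: x) d = a *: phi T t x d.
Proof.
move=> t0 dP; have lin := phi_linear _ _ t0 dP.
have phi00 : phi T t 0 d = 0.
  have := lin (-1) 0 0 => /=.
  by rewrite scaler0 addr0 scaleN1r addNr.
by have := lin a x 0 => /=; rewrite phi00 !addr0.
Qed.

Lemma phiB t d x y : 0 <= t -> piecewise_constant d ->
  phi T t (x - y) d = phi T t x d - phi T t y d.
Proof.
move=> t0 dP; have := phi_linear _ _ t0 dP (-1) y x => /=.
by rewrite !scaleN1r !(addrC (- _)).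
Qed.

End cocycle.

(** * Local boundedness and left continuity of C_0-semigroups *)

Section C0_semigroups.
Context {R : realType} {X : completeNormedModType R}.
Implicit Types (S : R -> X -> X) (t : R) (x y : X).

(** Rescaling any vector to norm [r] turns a bound on a ball into a bound by a
    multiple of the norm. *)
Lemma homogeneous_bound (f : X -> X) (M r : R) : 0 < r ->
  (forall (a : R) x, f (a *: x) = a *: f x) ->
  (forall x, `|x| <= r -> `|f x| <= M) -> forall x, `|f x| <= M / r * `|x|.
Proof.
move=> r0 fZ fM x; have [->|x0] := eqVneq x 0.
  by have := fZ 0 0; rewrite !scale0r => ->; rewrite !normr0 mulr0.
have x_gt0 : 0 < `|x| by rewrite normr_gt0.
pose a := r / `|x|; have a0 : 0 < a by rewrite divr_gt0.
have /fM : `|a *: x| <= r by rewrite normrZ gtr0_norm // divfK ?gt_eqF.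
rewrite fZ normrZ gtr0_norm // /a => H.
rewrite -(ler_pM2l a0) (le_trans H) // /a le_eqVlt; apply/orP; left.
by apply/eqP; field; rewrite ?gt_eqF.
Qed.

Lemma C0_semigroupZ S t (a : R) x : C0_semigroup S -> 0 <= t ->
  S t (a *: x) = a *: S t x.
Proof.
move=> [SL _ _ _] t0; have [lin _] := SL t t0.
pose f : {linear X -> X} := HB.pack (S t) (GRing.isLinear.Build _ _ _ _ _ lin).
exact: (linearZ_LR f a x).
Qed.

Lemma C0_semigroupB S t x y : C0_semigroup S -> 0 <= t ->
  S t (x - y) = S t x - S t y.
Proof.
move=> [SL _ _ _] t0; have [lin _] := SL t t0.
pose f : {linear X -> X} := HB.pack (S t) (GRing.isLinear.Build _ _ _ _ _ lin).
exact: (linearB f x y).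
Qed.

Lemma C0_semigroup_bounded S t : C0_semigroup S -> 0 <= t ->
  exists2 M, 0 < M & forall x, `|S t x| <= M * `|x|.
Proof.
move=> [SL _ _ _] t0; have [lin cont] := SL t t0.
pose f : {linear X -> X} := HB.pack (S t) (GRing.isLinear.Build _ _ _ _ _ lin).
have /linear_boundedP : bounded_near f (nbhs 0).
  by apply: continuous_linear_bounded; exact: cont.
by move=> /pinfty_ex_gt0[M M0 fM]; exists M.
Qed.

(** If the norms of [S t] were unbounded as [t] tends to 0, there would be times
    [u n] tending to 0 with the norm of [S (u n)] exceeding [n + 1]. But
    [S (u n) x] converges to [x], so these operators are pointwise bounded,
    which contradicts the uniform boundedness principle. *)
Lemma C0_semigroup_locally_bounded S : C0_semigroup S ->
  exists2 M, 0 < M & \forall t \near 0^'+, forall x, `|S t x| <= M * `|x|.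
Proof.
move=> SP; apply: contrapT => nbd.
have ex_t (n : nat) : exists t, [/\ 0 < t, t < n.+1%:R^-1 &
    ~ forall x, `|S t x| <= n.+1%:R * `|x|].
  apply: contrapT => not_t; apply: nbd; exists n.+1%:R => //.
  have n0 : 0 < n.+1%:R^-1 :> R by rewrite invr_gt0.
  apply: filterS2 (nbhs_right_gt 0) (nbhs_right_lt n0) => t t0 tn x.
  by apply: contrapT => tx; apply: not_t; exists t; split=> // /(_ x).
have [u uP] := choice ex_t.
have u_cvg : u @ \oo --> 0^'+.
  move=> P /nbhs_right0P; rewrite near_withinE => /nbhs_norm0P[e /= e0 eP].
  have := near_infty_natSinv_lt (PosNum e0); apply: filterS => n /= ne.
  have [u0 un _] := uP n; rewrite -[u n]add0r; apply: eP => //=.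
  by rewrite gtr0_norm // (lt_trans un).
have [_ _ _ S_cvg] := SP.
have /(_ 1)[M MP] : uniform_bounded (range (fun n => S (u n))).
  apply: Banach_Steinhauss => [_ [n _ <-]|x].
    have u0 : 0 <= u n by have [/ltW] := uP n.
    have [M M0 SM] := C0_semigroup_bounded _ _ SP u0.
    split; last by case: SP => /(_ _ u0)[].
    by move=> r; exists (M * r) => x xr; rewrite (le_trans (SM x)) // ler_pM2l.
  have : bounded_fun (fun n => S (u n) x).
    apply: cvg_seq_bounded; apply/cvg_ex; exists x.
    exact: cvg_comp u_cvg (S_cvg x).
  by move=> /pinfty_ex_gt0[M _ SM]; exists M => _ [n _ <-]; exact: SM.
have [n Mn] : exists n : nat, M <= n.+1%:R.
  by exists (Num.truncn M); exact/ltW/truncnS_gt.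
have [/ltW u0 _] := uP n; apply.
have fZ a x := C0_semigroupZ S (u n) a x SP u0.
move=> x; rewrite -[n.+1%:R]divr1; apply: homogeneous_bound => // y y1.
by rewrite (le_trans _ Mn) //; apply: MP => //; exists n.
Qed.

(** For a fixed small [k] and [s < k], the difference [S t x - S (t - s) x] is
    [S (t - k) (S (k - s) (S s x - x))]: the first operator is fixed, the second
    one is bounded near 0, and the last factor tends to 0 with [s]. *)
Lemma C0_semigroup_left_continuous S t x : C0_semigroup S -> 0 < t ->
  S r x @[r --> t^'-] --> S t x.
Proof.
move=> SP t0.
have [M M0 /nbhs_right0P] := C0_semigroup_locally_bounded _ SP.
rewrite near_withinE => /nbhs_norm0P[h /= h0 SM].
have [SL _ SD S_cvg] := SP.
(* [k] must lie within the range [h] of the local bound and not exceed [t]. *)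
pose k := Num.min (h / 2) t.
have k0 : 0 < k by rewrite lt_min t0 divr_gt0.
have kh : k < h by rewrite gt_min; apply/orP; left; lra.
have kt : k <= t by rewrite ge_min lexx orbT.
have tk0 : 0 <= t - k by rewrite subr_ge0.
have [L L0 SLk] := C0_semigroup_bounded _ _ SP tk0.
apply/cvgrPdist_lt => e e0; apply/nbhs_left0P.
have eLM : 0 < e / (L * M) by rewrite divr_gt0 ?mulr_gt0.
have /cvgrPdist_lt/(_ _ eLM) := S_cvg x.
apply: filterS3 (nbhs_right_lt k0) (nbhs_right_gt 0) => s sk s0 Sx.
have ks0 : 0 <= k - s by lra.
have tkE y : S (t - k) (S (k - s) y) = S (t - s) y.
  by rewrite -SD //; congr (S _ y); lra.
have stE : S (t - s) (S s x) = S t x.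
  by rewrite -SD ?subrK ?ltW //; lra.
rewrite -stE -C0_semigroupB -?tkE //; last lra.
rewrite (le_lt_trans (SLk _)) // -ltr_pdivlMl //.
have {}SM : `|S (k - s) (S s x - x)| <= M * `|S s x - x|.
  by rewrite -[k - s]add0r; apply: SM; rewrite /= ?gtr0_norm; lra.
rewrite (le_lt_trans SM) // -ltr_pdivlMl // distrC.
rewrite (lt_le_trans Sx) // le_eqVlt; apply/orP; left.
by apply/eqP; field; rewrite !gt_eqF.
Qed.

End C0_semigroups.

(** * Lower limits, and weak attractivity from a Lyapunov function *)

Section lower_limits.
Context {R : realType}.

Lemma limf_einf_lt_ex {U : choiceType} {Y : filteredType U} (f : Y -> \bar R)
    (F : set_system Y) (A : set Y) (l : \bar R) : F A -> (limf_einf f F < l)%E ->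
  exists2 x, A x & (f x < l)%E.
Proof.
move=> FA fl; have : (ereal_inf (f @` A) < l)%E.
  apply: le_lt_trans fl; rewrite limf_einfE; apply: ereal_sup_ubound.
  by exists A.
by case/ereal_inf_lt => _ [x Ax <-] fxl; exists x.
Qed.

Lemma limf_einf_le_near {U : choiceType} {Y : filteredType U} (f : Y -> \bar R)
    (F : set_system Y) {FF : ProperFilter F} (l : \bar R) :
  (\forall x \near F, (f x <= l)%E) -> (limf_einf f F <= l)%E.
Proof.
move=> fl; rewrite limf_einfE; apply: ge_ereal_sup => _ [A FA <-].
have [x [Ax fxl]] := filter_ex (filterI FA fl).
by apply: ereal_inf_le; exists (f x) => //; exists x.
Qed.

(** The supremum of the times at which the claimed decrease holds is such a time
    by left continuity; were it smaller than [tau], the right-hand condition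
    would provide a later one. *)
Lemma lower_right_decrease (v : R -> R) (c tau : R) : 0 <= tau ->
  (forall t, 0 < t -> t <= tau -> v r @[r --> t^'-] --> v t) ->
  (forall t h, 0 <= t -> t < tau -> 0 < h ->
     exists k, [/\ 0 < k, k < h & v (t + k) <= v t - c * k]) ->
  v tau <= v 0 - c * tau.
Proof.
move=> tau0 v_left v_right.
pose E := [set t | [/\ 0 <= t, t <= tau & v t <= v 0 - c * t]].
have E0 : E 0 by split; rewrite // mulr0 subr0.
have E_sup : has_sup E by split; [exists 0|exists tau => t []].
have E_le t : E t -> t <= sup E by exact: sup_upper_bound.
have s0 : 0 <= sup E by exact: E_le.
have stau : sup E <= tau by apply: ge_sup => [|t []//]; exists 0.
have Es : E (sup E).
  apply: contrapT => nEs.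
  have s_gt0 : 0 < sup E.
    by rewrite lt_neqAle s0 andbT; apply/eqP => s_eq; apply: nEs; rewrite -s_eq.
  have vs : v 0 - c * sup E < v (sup E).
    by rewrite ltNge; apply/negP => ?; apply: nEs.
  have w_cvg : v r + c * r @[r --> (sup E)^'-] --> v (sup E) + c * sup E.
    apply: cvgD; first exact: v_left.
    by apply: cvg_at_left_filter; apply: cvgM; [exact: cvg_cst|exact: cvg_id].
  have : \forall r \near (sup E)^'-, v 0 < v r + c * r.
    by apply: cvgr_gt w_cvg _ _; lra.
  move=> /nbhs_left0P; rewrite near_withinE => /nbhs_norm0P[h /= h0 vh].
  have [t Et st] := sup_adherent h0 E_sup.
  have ts := E_le t Et.
  have [tE|tNs] := eqVneq t (sup E); first by apply: nEs; rewrite -tE.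
  have ts' : t < sup E by rewrite lt_neqAle tNs.
  have := vh (sup E - t); rewrite /= gtr0_norm ?subr_gt0 // => H.
  have := H ltac:(lra) ltac:(lra); rewrite subKr.
  by case: Et => _ _; lra.
have [_ _ vs] := Es.
have [taus|stau'] := leP tau (sup E).
  by rewrite (_ : tau = sup E) //; apply/le_anti; rewrite taus.
have [k [k0 kh vk]] := v_right (sup E) (tau - sup E) s0 stau' ltac:(lra).
have : E (sup E + k) by split; lra.
by move/E_le; lra.
Qed.

End lower_limits.

Section weak_attractivity.
Context {R : realType} {Q : Type} {X : completeNormedModType R}.
Context {T : Q -> R -> X -> X}.
Hypothesis TC0 : forall q, C0_semigroup (T q).
Implicit Types (d : R -> Q) (s t : R) (x y : X).

(** A subdivision of [[0, t]] has a last piece, and it ends at [t]. *)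
Lemma constant_before d t : piecewise_constant d -> 0 < t ->
  exists s, [/\ 0 <= s, s < t & {in `[s, t[, forall r, d r = d s}].
Proof.
move=> dP t0; have [p [pP pc]] := admissible_exists dP (lexx 0) (ltW t0).
case/lastP: p pP pc => [/itv_partition_nil t0'|p u].
  by move: t0; rewrite -t0' ltxx.
rewrite /itv_partition rcons_path last_rcons => -[/andP[p0 pu] /eqP ut].
rewrite -cats1 => /constant_along_cat[_ [dc _]]; rewrite ut in pu dc.
exists (last 0 p); split=> //.
by apply: (@itv_partition_le _ _ _ _ p); split.
Qed.

Lemma phi_left_continuous d t x : piecewise_constant d -> 0 < t ->
  phi T r x d @[r --> t^'-] --> phi T t x d.
Proof.
move=> dP t0; have [s [s0 st dc]] := constant_before d t dP t0.
have phiE r : s <= r -> r <= t -> phi T r x d = T (d s) (r - s) (phi T s x d).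
  move=> sr rt; rewrite -{1}(subrKC s r) phiD //; last lra.
  rewrite phi_cst //; first by rewrite /shift_signal addr0.
    by lra.
  move=> u; rewrite in_itv /= => us; rewrite /shift_signal addr0.
  by apply: dc; rewrite in_itv /=; lra.
rewrite (phiE t) //; last lra.
apply/cvgrPdist_lt => e e0; apply/nbhs_left0P.
have ts0 : 0 < t - s by rewrite subr_gt0.
have := C0_semigroup_left_continuous _ _ (phi T s x d) (TC0 (d s)) ts0.
move=> /cvgrPdist_lt/(_ _ e0)/nbhs_left0P.
apply: filterS3 (nbhs_right_gt 0) (nbhs_right_lt ts0) => h h0 hts.
rewrite (phiE (t - h)); [|lra|lra].
by rewrite (_ : t - h - s = t - s - h) //; ring.
Qed.

(** While the norm exceeds [eps], the lower right derivative of V along the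
    solution is less than [- alpha eps / 2], and V starts below [psi r] on the
    ball of radius [r]. Staying away for a time [2 (psi r + 1) / alpha eps]
    would thus make V negative. *)
Lemma noncoercive_lyapunov_weakly_attractive V :
  noncoercive_lyapunov T V -> uniformly_globally_weakly_attractive T.
Proof.
move=> [V_cont V_ge0 V0 [psi [alpha [[[_ psi_incr psi0] _]]]]].
move=> [_ alpha_incr alpha0] V_le V_decr eps r eps0 r0.
have alpha_eps : 0 < alpha eps.
  by rewrite -alpha0; apply: alpha_incr => //; rewrite in_itv /= ?lexx ?ltW.
have psi_r : 0 < psi r.
  by rewrite -psi0; apply: psi_incr => //; rewrite in_itv /= ?lexx ?ltW.
(* A lower limit that is at most [- alpha eps] only yields difference quotients
   below numbers greater than [- alpha eps], such as [- c]. *)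
pose c := alpha eps / 2.
have c0 : 0 < c by rewrite divr_gt0.
pose tau := (psi r + 1) / c.
have tau0 : 0 < tau by rewrite divr_gt0 //; lra.
exists tau => x d xr dP; apply: contrapT => far.
have {}far t : 0 <= t -> t <= tau -> eps < `|phi T t x d|.
  move=> t0 tt; rewrite ltNge; apply/negP => near_t; apply: far.
  by exists t; rewrite ?t0.
have x_gt : eps < `|x| by rewrite -(phi0 TC0 d x); apply: far => //; exact: ltW.
have : V (phi T tau x d) <= V (phi T 0 x d) - c * tau.
  apply: (@lower_right_decrease _ (fun t => V (phi T t x d))); first exact: ltW.
    move=> t t0 _.
    by apply: (cvg_comp _ _ (phi_left_continuous _ _ _ dP t0)); exact: V_cont.
  move=> t h t0 tt h0; have dtP := piecewise_constant_shift _ _ t0 dP.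
  have rate : (lie_derivative T V (shift_signal t d) (phi T t x d) < (- c)%:E)%E.
    apply: le_lt_trans (V_decr _ _ dtP) _; rewrite lte_fin ltrN2.
    have : alpha eps < alpha `|phi T t x d|.
      apply: alpha_incr; rewrite ?in_itv /= ?normr_ge0 ?ltW //.
      by apply: far => //; exact: ltW.
    by rewrite /c; lra.
  have [] := limf_einf_lt_ex _ _ [set k | 0 < k < h] _ _ rate.
    by apply: filterS2 (nbhs_right_gt 0) (nbhs_right_lt h0) => k /= -> ->.
  move=> k /= /andP[k0 kh]; rewrite lte_fin ltr_pdivrMl // => Vk.
  by exists k; split=> //; rewrite phiD //; lra.
rewrite phi0 //; have -> : c * tau = psi r + 1.
  by rewrite /tau mulrC divfK ?gt_eqF.
have := V_ge0 (phi T tau x d).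
have : V x <= psi r; last by lra.
have x0 : x != 0 by rewrite -normr_gt0; lra.
have /andP[_ /le_trans-> //] := V_le x x0.
have [->//|xNr] := eqVneq `|x| r; apply/ltW/psi_incr.
- by rewrite in_itv /= normr_ge0.
- by rewrite in_itv /= ltW.
- by rewrite lt_neqAle xNr.
Qed.

End weak_attractivity.

(** * Exponential stability from contraction *)

Section uniform_stability.
Context {R : realType} {Q : Type} {X : completeNormedModType R}.
Context {T : Q -> R -> X -> X}.
Hypothesis TC0 : forall q, C0_semigroup (T q).
Implicit Types (d : R -> Q) (s t : R) (x y : X).

Lemma phi_homogeneous_bound d t (M r : R) : piecewise_constant d -> 0 <= t ->
  0 < r -> (forall x, `|x| <= r -> `|phi T t x d| <= M) ->
  forall x, `|phi T t x d| <= M / r * `|x|.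
Proof.
move=> dP t0 r0; apply: (@homogeneous_bound _ _ (phi T t ^~ d)) => // a x.
exact: phiZ.
Qed.

(** A finite supremum over the unit ball is a bound on operator norms. *)
Lemma robustly_forward_complete_bounded tau :
  robustly_forward_complete T -> 0 < tau ->
  exists2 M, 0 <= M & forall x d t, piecewise_constant d ->
    0 <= t -> t <= tau -> `|phi T t x d| <= M * `|x|.
Proof.
move=> rfc tau0; have := rfc 1 tau ltr01 tau0.
set S := [set z | _] => S_lt; have [M SM] : exists M, ubound S (M%:E).
  (* The supremum is -oo when there is no signal at all, hence the maximum
     with 0. *)
  exists (fine (Order.max (ereal_sup S) 0%E)) => z Sz.
  rewrite fineK; first by rewrite le_max ereal_sup_ubound.
  by rewrite fin_numE; apply/andP; split; [rewrite gt_eqF // lt_max ltNy0 orbT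
    |rewrite lt_eqF // gt_max S_lt ltry].
exists `|M| => // x d t dP t0 tt; rewrite -[`|M|]divr1.
apply: phi_homogeneous_bound => // {}x x1; rewrite (le_trans _ (ler_norm M)) //.
by rewrite -lee_fin; apply: SM; exists x, t, d; split; rewrite ?t0.
Qed.

(** By homogeneity, a time at which the solution starting from the unit vector
    along [x] lies in the ball of radius [c] is also a time at which the one
    starting from [x] has been contracted by [c]. *)
Lemma weakly_attractive_contracts (c : R) :
  uniformly_globally_weakly_attractive T -> 0 < c ->
  exists2 tau, 0 < tau & forall x d, piecewise_constant d ->
    exists t, [/\ 0 <= t, t <= tau & `|phi T t x d| <= c * `|x|].
Proof.
move=> wa c0; have [tau tauP] := wa c 1 c0 ltr01.
exists (Num.max tau 1) => [|x d dP]; first by rewrite lt_max ltr01 orbT.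
have [->|x0] := eqVneq x 0.
  exists 0; rewrite phi0 // normr0 mulr0; split=> //.
  by rewrite le_max ler01 orbT.
have x_gt0 : 0 < `|x| by rewrite normr_gt0.
have [||t /andP[t0 tt]] := tauP (`|x|^-1 *: x) d; rewrite ?dP //.
  by rewrite normrZ gtr0_norm ?invr_gt0 // mulVf ?gt_eqF.
rewrite phiZ // normrZ gtr0_norm ?invr_gt0 // ler_pdivrMl // mulrC => xc.
by exists t; split=> //; rewrite le_max tt.
Qed.

(** Let [K] be the supremum of the operator norms up to time [t], finite by
    robust forward completeness. A solution at a time after [tau] is a solution
    restarted from a state whose norm was halved, hence [K <= M + K / 2]. It is
    essential that [K] is known to be finite and that the resulting bound
    [2 * M] does not depend on [t]. *)
Lemma weakly_attractive_uniformly_bounded :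
  robustly_forward_complete T -> uniformly_globally_weakly_attractive T ->
  exists2 M, 0 <= M & forall x d t, piecewise_constant d -> 0 <= t ->
    `|phi T t x d| <= M * `|x|.
Proof.
move=> rfc wa.
have [tau tau0 tauP] : exists2 tau, 0 < tau & forall x d, piecewise_constant d ->
    exists t, [/\ 0 <= t, t <= tau & `|phi T t x d| <= 2^-1 * `|x|].
  by apply: weakly_attractive_contracts => //; rewrite invr_gt0.
have [M M0 MP] := robustly_forward_complete_bounded _ rfc tau0.
exists (2 * M) => [|x d t dP t0]; first by rewrite mulr_ge0.
pose E := [set z | exists y e s, [/\ `|y| <= 1, piecewise_constant e,
  0 <= s <= t & z = `|phi T s y e|]].
have [B B0 BP] : exists2 B, 0 <= B & forall x d s, piecewise_constant d ->
    0 <= s -> s <= t + 1 -> `|phi T s x d| <= B * `|x|.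
  by apply: robustly_forward_complete_bounded => //; lra.
have E_ub : has_ubound E.
  exists B => _ [y [e [s [y1 eP /andP[s0 st] ->]]]].
  have /le_trans-> // := BP y e s eP s0 ltac:(lra).
  by rewrite ler_piMr.
have EK y e s : piecewise_constant e -> 0 <= s -> s <= t ->
    `|phi T s y e| <= sup E * `|y|.
  move=> eP s0 st; rewrite -[sup E]divr1.
  apply: phi_homogeneous_bound => // z z1; apply: ub_le_sup => //.
  by exists z, e, s; rewrite s0.
have K0 : 0 <= sup E.
  apply: le_trans (ub_le_sup E_ub _); last first.
    by exists 0, d, 0; rewrite normr0 lexx t0.
  exact: normr_ge0.
have : sup E <= M + sup E / 2.
  apply: ge_sup; first by exists `|phi T 0 0 d|, 0, d, 0; rewrite normr0 lexx t0.
  move=> _ [y [e [s [y1 eP /andP[s0 st] ->]]]].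
  have [stau|taus] := leP s tau.
    rewrite (le_trans (MP y e s eP s0 stau)) // (@le_trans _ _ M) //.
      by rewrite ler_piMr.
    lra.
  have [u [u0 ut uP]] := tauP y e eP.
  rewrite -[s](subrKC u) phiD //; last by lra.
  have := EK (phi T u y e) (shift_signal u e) (s - u).
  move=> /(_ (piecewise_constant_shift _ _ u0 eP) ltac:(lra) ltac:(lra)).
  move=> /le_trans; apply.
  apply: (@le_trans _ _ (sup E * (2^-1 * `|y|))); first by rewrite ler_wpM2l.
  rewrite (@le_trans _ _ (sup E / 2)) //; last lra.
  by rewrite ler_wpM2l // ler_piMr // invr_ge0.
move=> K2M; apply: le_trans (EK x d t dP t0 (lexx t)) _.
by rewrite ler_wpM2r //; lra.
Qed.

(** Over [n] periods of length [tau] the norm is divided by [e ^ n]; taking for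
    [n] the integer part of [t / tau] costs at most one more factor [e]. *)
Lemma contraction_exponentially_stable (M tau : R) : 0 < tau -> 0 <= M ->
  (forall x d t, piecewise_constant d -> 0 <= t ->
     `|phi T t x d| <= M * `|x|) ->
  (forall x d, piecewise_constant d -> `|phi T tau x d| <= expR (-1) * `|x|) ->
  exponentially_stable T.
Proof.
move=> tau0 M0 MP tauP.
have iter (n : nat) x d t : piecewise_constant d -> n%:R * tau <= t ->
    `|phi T t x d| <= M * expR (- n%:R) * `|x|.
  elim: n x d t => [|n IH] x d t dP; rewrite ?mul0r => nt.
    by rewrite oppr0 expR0 mulr1; exact: MP.
  have t_tau : n%:R * tau <= t - tau by rewrite -natr1 in nt; lra.
  have t_ge : 0 <= t - tau by rewrite (le_trans _ t_tau) // mulr_ge0 // ltW.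
  rewrite -[t](subrKC tau) phiD ?(ltW tau0) //.
  have := IH (phi T tau x d) _ _ (piecewise_constant_shift _ _ (ltW tau0) dP) t_tau.
  move=> /le_trans; apply.
  rewrite -natr1 opprD expRD -!mulrA.
  by apply: ler_wpM2l => //; apply: ler_wpM2l; [exact: expR_ge0|exact: tauP].
exists (Num.max 1 (M * expR 1)), tau^-1; split; first by rewrite le_max lexx.
  by rewrite invr_gt0.
move=> x d t dP t0; pose n := Num.truncn (t / tau).
have /andP[nt tn] : n%:R <= t / tau < n.+1%:R.
  by apply: truncn_itv; rewrite divr_ge0 // ltW.
have := iter n x d t dP; rewrite -ler_pdivlMr // => /(_ nt) /le_trans; apply.
apply: ler_wpM2r => //.
apply: (@le_trans _ _ (M * expR 1 * expR (- tau^-1 * t))).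
  rewrite -mulrA; apply: ler_wpM2l => //; rewrite -expRD ler_expR.
  by rewrite -natr1 in tn; rewrite mulNr [_^-1 * _]mulrC; lra.
by rewrite ler_wpM2r ?expR_ge0 // le_max lexx orbT.
Qed.

(** A solution that has been contracted by a factor [(M + 1) e] at some time
    before [tau] can have grown again by a factor of at most [M] at time [tau].
    The factor uses [M + 1] to avoid a division by 0 when [M = 0]. *)
Lemma weakly_attractive_exponentially_stable :
  robustly_forward_complete T -> uniformly_globally_weakly_attractive T ->
  exponentially_stable T.
Proof.
move=> rfc wa; have [M M0 MP] := weakly_attractive_uniformly_bounded rfc wa.
have M1 : 0 < M + 1 by lra.
have [tau tau0 tauP] : exists2 tau, 0 < tau & forall x d, piecewise_constant d ->
    exists t, [/\ 0 <= t, t <= tau &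
      `|phi T t x d| <= expR (-1) / (M + 1) * `|x|].
  by apply: weakly_attractive_contracts => //; rewrite divr_gt0 ?expR_gt0.
apply: (contraction_exponentially_stable M tau) => // x d dP.
have [t [t0 tt tP]] := tauP x d dP.
rewrite -[tau](subrKC t) phiD ?subr_ge0 //.
have := MP (phi T t x d) _ (tau - t) (piecewise_constant_shift _ _ t0 dP).
rewrite subr_ge0 => /(_ tt) /le_trans; apply.
apply: (@le_trans _ _ ((M + 1) * (expR (-1) / (M + 1) * `|x|))).
  by apply: ler_pM => //; lra.
by rewrite mulrA [(M + 1) * _]mulrC divfK // gt_eqF.
Qed.

Lemma UGAS_exponentially_stable : UGAS T -> exponentially_stable T.
Proof.
move=> [beta [_ betaL] betaP].
have [_ beta_ge0 beta_decr beta_cvg] := betaL 1 ltr01.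
have linear_bound x d t : piecewise_constant d -> 0 <= t ->
    `|phi T t x d| <= beta 1 t * `|x|.
  move=> dP t0; have [->|x0] := eqVneq x 0.
    by rewrite -(scale0r (0 : X)) phiZ // !scale0r normr0 mulr0.
  have x_gt0 : 0 < `|x| by rewrite normr_gt0.
  have := betaP (`|x|^-1 *: x) d t dP t0.
  rewrite phiZ // !normrZ gtr0_norm ?invr_gt0 // mulVf ?gt_eqF //.
  by rewrite ler_pdivrMl // mulrC.
have [tau [tau0 tauP]] : exists tau, 0 < tau /\ beta 1 tau < expR (-1).
  have : \forall t \near +oo, beta 1 t < expR (-1).
    by apply: cvgr_lt beta_cvg _ _; exact: expR_gt0.
  by move=> /pinfty_ex_gt0[tau tau0 ?]; exists tau.
have b0 : 0 <= beta 1 0 by apply: beta_ge0; rewrite in_itv /= lexx.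
apply: (contraction_exponentially_stable (beta 1 0) tau) => //.
  move=> x d t dP t0; apply: le_trans (linear_bound x d t dP t0) _.
  by rewrite ler_wpM2r //; apply: beta_decr; rewrite ?in_itv /= ?lexx ?t0.
move=> x d dP; apply: le_trans (linear_bound x d tau dP (ltW tau0)) _.
by rewrite ler_wpM2r // ltW.
Qed.

Lemma exponentially_stable_UGAS : exponentially_stable T -> UGAS T.
Proof.
move=> [M [w [M1 w0 stab]]].
have M0 : 0 < M by lra.
have Me0 t : 0 < M * expR (- w * t) by rewrite mulr_gt0 ?expR_gt0.
exists (fun r t => M * expR (- w * t) * r); last by move=> x d t; exact: stab.
split=> [t t0|r r0]; first exact: classK_linear.
split.
- apply: continuous_subspaceT => t; apply: cvgM; last exact: cvg_cst.
  apply: cvgM; first exact: cvg_cst.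
  apply: continuous_comp; last exact: continuous_expR.
  by apply: cvgM; [exact: cvg_cst|exact: cvg_id].
- by move=> t _; rewrite mulr_ge0 // ltW.
- move=> t s _ _ ts; apply: ler_wpM2r; first exact: ltW.
  by apply: ler_wpM2l; [exact: ltW|rewrite ler_expR !mulNr lerN2 ler_pM2l].
- rewrite -(mul0r r) -[X in _ --> X * r](mulr0 M).
  apply: cvgM; last exact: cvg_cst.
  apply: cvgM; first exact: cvg_cst.
  under eq_fun do rewrite mulNr.
  have wt : w * t @[t --> +oo] --> +oo by apply: gt0_cvgMry => //; exact: cvg_id.
  by apply: (cvg_comp _ (fun u => expR (- u)) wt); exact: cvgr_expR.
Qed.

End uniform_stability.

(** * A Lyapunov function from exponential stability *)

Section converse_lyapunov.
Context {R : realType} {Q : Type} {X : completeNormedModType R}.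
Context {T : Q -> R -> X -> X}.
Hypothesis TC0 : forall q, C0_semigroup (T q).
Implicit Types (d : R -> Q) (s t : R) (x y : X).

(** A bound that is linear in [u], at half of the slope at 0: it holds for all
    small times at once, so that no derivative has to be computed. *)
Lemma expRN_le_1Bhalf (u : R) : 0 <= u -> u <= 1 -> expR (- u) <= 1 - u / 2.
Proof.
move=> u0 u1; rewrite expRN -[_^-1]div1r ler_pdivrMr ?expR_gt0 //.
have := expR_ge1Dx u => eu.
apply: (@le_trans _ _ ((1 - u / 2) * (1 + u))); first by nra.
by apply: ler_wpM2l => //; lra.
Qed.

(** The norm of [x] itself is included so that the supremum is a norm even when
    the set of signals is empty. *)
Definition weighted_orbit (w : R) x : set R :=
  [set z | z = `|x| \/ exists d t, [/\ piecewise_constant d, 0 <= t &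
    z = expR (w * t) * `|phi T t x d|]].

Lemma exponentially_stable_noncoercive_lyapunov :
  exponentially_stable T -> exists V, noncoercive_lyapunov T V.
Proof.
move=> [M [w [M1 w0 stab]]]; have M0 : 0 < M by lra.
pose V x := sup (weighted_orbit w x).
have orbit_le x z : weighted_orbit w x z -> z <= M * `|x|.
  move=> [->|[d [t [dP t0 ->]]]]; first by rewrite ler_peMl.
  rewrite -ler_pdivlMl ?expR_gt0 // (le_trans (stab x d t dP t0)) // mulNr.
  by rewrite expRN mulrA [M * _]mulrC.
have orbit0 x : weighted_orbit w x !=set0 by exists `|x|; left.
have orbit_ub x : has_ubound (weighted_orbit w x).
  by exists (M * `|x|) => z; exact: orbit_le.
have V_le x : V x <= M * `|x| by apply: ge_sup => // z; exact: orbit_le.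
have V_norm x : `|x| <= V x by apply: ub_le_sup => //; left.
have V_ge x d t : piecewise_constant d -> 0 <= t ->
    expR (w * t) * `|phi T t x d| <= V x.
  by move=> dP t0; apply: ub_le_sup => //; right; exists d, t.
have V_sub x y : V x <= V y + M * `|x - y|.
  apply: (@le_trans _ _ (V y + V (x - y))); last by rewrite lerD2l.
  apply: ge_sup => // _ [->|[d [t [dP t0 ->]]]].
    rewrite -{1}[x](subrKC y) (le_trans (ler_normD _ _)) //.
    by rewrite lerD.
  rewrite (le_trans _ (lerD (V_ge y d t dP t0) (V_ge (x - y) d t dP t0))) //.
  rewrite -mulrDr phiB //; apply: ler_wpM2l; first exact: expR_ge0.
  by rewrite (le_trans _ (ler_normD _ _)) // subrKC.
have V_decay x d h : piecewise_constant d -> 0 <= h ->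
    V (phi T h x d) <= expR (- (w * h)) * V x.
  move=> dP h0; have e_gt0 := expR_gt0 (w * h).
  apply: ge_sup => // _ [->|[e [t [eP t0 ->]]]].
    by rewrite expRN ler_pdivlMl // V_ge.
  (* A solution starting from [phi T h x d] is the end of a solution starting
     from [x], driven by a concatenated signal. *)
  rewrite -phi_concat // expRN ler_pdivlMl // mulrA -expRD -mulrDr.
  by apply: V_ge; [exact: piecewise_constant_concat|rewrite addr_ge0].
exists V; split.
- move=> x; apply/cvgrPdist_lt => e e0.
  have eM : 0 < e / M by rewrite divr_gt0.
  apply/nbhs_normP; exists (e / M) => //= y /=; rewrite ltr_pdivlMr // mulrC => xy.
  apply: le_lt_trans xy; rewrite ler_norml; apply/andP; split.
    by have := V_sub y x; rewrite [`|y - x|]distrC; lra.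
  by have := V_sub x y; lra.
- by move=> x; apply: le_trans (V_norm x).
- apply/le_anti; rewrite (le_trans _ (V_norm 0)) // andbT.
  by have := V_le 0; rewrite normr0 mulr0.
exists (fun r => M * r), (fun r => w / 2 * r); split.
- exact: classKoo_linear.
- by apply: classK_linear; rewrite divr_gt0.
- by move=> x x0; rewrite V_le andbT (lt_le_trans _ (V_norm x)) // normr_gt0.
move=> x d dP; apply: limf_einf_le_near.
have iw0 : 0 < w^-1 by rewrite invr_gt0.
apply: filterS2 (nbhs_right_gt 0) (nbhs_right_lt iw0) => h h0 hw.
have wh0 : 0 <= w * h by rewrite mulr_ge0 // ltW.
have wh1 : w * h <= 1 by rewrite -ler_pdivlMl // mulr1 ltW.
rewrite lee_fin ler_pdivrMl // mulrN.
have := V_decay x d h dP (ltW h0).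
have : expR (- (w * h)) * V x <= (1 - w * h / 2) * V x.
  apply: ler_wpM2r; first exact: le_trans (V_norm x).
  exact: expRN_le_1Bhalf.
have : w * h / 2 * `|x| <= w * h / 2 * V x.
  by apply: ler_wpM2l => //; rewrite divr_ge0.
have -> : h * (w / 2 * `|x|) = w * h / 2 * `|x| by ring.
by lra.
Qed.

End converse_lyapunov.

(** * Non-coercive Lyapunov functions and stability *)

Theorem corollary4p5 (R : realType) (X : completeNormedModType R) (Q : Type)
    (A : Q -> linear_operator X) (T : Q -> R -> X -> X)
    (closedA : forall q, closed_operator (A q))
    (semigroupT : forall q, C0_semigroup (T q))
    (generatesA : forall q, generates (A q) (T q)) :
  ((exists V : X -> R, noncoercive_lyapunov T V) ->
    uniformly_globally_weakly_attractive T)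
  /\
  (robustly_forward_complete T ->
    ((exists V : X -> R, noncoercive_lyapunov T V) <-> UGAS T) /\
    (UGAS T -> exponentially_stable T)).
Proof.
have weak V := @noncoercive_lyapunov_weakly_attractive _ _ _ _ semigroupT V.
split=> [[V /weak //]|rfc]; split; last exact: UGAS_exponentially_stable.
split=> [[V /weak wa]|/(UGAS_exponentially_stable semigroupT)].
  apply: exponentially_stable_UGAS.
  exact: weakly_attractive_exponentially_stable.
exact: exponentially_stable_noncoercive_lyapunov.
Qed.
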